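(* Let $n\ge1$, $\lambda\in\mathbb{C}^n$, $H_2=\sum_{j=1}^n\lambda_jx_jy_j$, $H=H_2+H_3+H_4+\ldots$, where $H_j$ is a homogeneous form of degree $j$ in $(x,y)$, and let $H_2+N_3+N_4+\ldots$ be the normal form of $H$, where $N_m$ is homogeneous of degree $m$ in $(x,y)$. Then for every $m\ge3$ $$N_m=\sum_{s=1}^{m-2}\ \sum_{j_1+\ldots+j_s=m-2+2s}\mathcal{A}\,\Lambda_s(H_{j_1},\ldots,H_{j_s}),$$ where all $j_i\ge3$ and $\Lambda_s$, $s\ge1$, are the $s$-linear operators on $\mathcal{F}$ (not depending on $m$) defined recursively in the context.
   Context: $\mathcal{F}$ is the space of formal power series $\sum f_{\alpha\beta}x^\alpha y^\beta$, $|\alpha|+|\beta|\ge3$, with complex coefficients in $x=(x_1,\dots,x_n)$, $y=(y_1,\dots,y_n)$. Poisson bracket: $\{F_1,F_2\}=\sum_{j=1}^n\bigl(\frac{\partial F_1}{\partial y_j}\frac{\partial F_2}{\partial x_j}-\frac{\partial F_1}{\partial x_j}\frac{\partial F_2}{\partial y_j}\bigr)$. With $\langle\gamma,\lambda\rangle=\sum_j\gamma_j\lambda_j$, the operators $\mathcal{A},\mathcal{B}$ on $\mathcal{F}$ are $$\mathcal{A}F=\sum_{\langle\alpha-\beta,\lambda\rangle=0}f_{\alpha\beta}x^\alpha y^\beta,\qquad \mathcal{B}F=\sum_{\langle\alpha-\beta,\lambda\rangle\ne0}\frac{f_{\alpha\beta}}{\langle\alpha-\beta,\lambda\rangle}x^\alpha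 y^\beta .$$ Normal form: let $e^{\{F,\cdot\}}H=H+\frac1{1!}\{F,H\}+\frac1{2!}\{F,\{F,H\}\}+\ldots$. The normal form of $H$ is $H_2+N_3+N_4+\ldots=e^{\{F,\cdot\}}H$, where $F\in\mathcal{F}$ is the unique series with $\mathcal{A}F=0$ for which $N_*=N_3+N_4+\ldots$ satisfies $\mathcal{A}N_*=N_*$. Definition of $\Lambda_s$: for an $s_1$-linear operator $P$ and an $s_2$-linear operator $R$ on $\mathcal{F}$, $\{P,R\}$ denotes the $(s_1+s_2)$-linear operator $(G_1,\ldots,G_{s_1+s_2})\mapsto\{P(G_1,\ldots,G_{s_1}),R(G_{s_1+1},\ldots,G_{s_1+s_2})\}$; $\mathcal{A}P,\mathcal{B}P$ denote compositions; $I$ is the identity operator. Then $\Lambda_1=I$ and, for $s\ge2$, $$\Lambda_s=\sum_{k\ge1}\frac1{k!}\sum_{s_1+\ldots+s_k=s-1}\{\mathcal{B}\Lambda_{s_1},\{\mathcal{B}\Lambda_{s_2},\ldots\{\mathcal{B}\Lambda_{s_k},I\}\ldots\}\}+\sum_{k\ge1}\frac1{(k+1)!}\sum_{s_1+\ldots+s_{k+1}=s}\{\mathcal{B}\Lambda_{s_1},\{\mathcal{B}\Lambda_{s_2},\ldots\{\mathcal{B}\Lambda_{s_k},(\mathcal{A}-I)\Lambda_{s_{k+1}}\}\ldots\}\},$$ with all $s_i\ge1$. *)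

(* Defs.v *)
From HB Require Import structures.
From mathcomp Require Import all_boot all_order all_algebra.
From mathcomp Require Import mpoly.
From mathcomp Require Import functions reals complex.

Set Implicit Arguments.
Unset Strict Implicit.
Unset Printing Implicit Defensive.

Import GRing.Theory.

Local Open Scope ring_scope.

(* Formal power series in x = (x_1, ..., x_n) and y = (y_1, ..., y_n):
   [f a b] is the coefficient of x^a y^b.  K^o is K seen as a module over
   itself, so that series form a K-module for the pointwise operations. *)
Notation series K n := ('X_{1..n} -> 'X_{1..n} -> K^o).

Section Series.
Variables (K : fieldType) (n : nat).
Implicit Types (f g F G H N : series K n) (a b : 'X_{1..n}) (lam : 'I_n -> K).

Definition in_F f := forall a b, (mdeg a + mdeg b < 3)%N -> f a b = 0.

Definition hpart (m : nat) f : series K n :=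
  fun a b => if (mdeg a + mdeg b == m)%N then f a b else 0.

(* Cauchy product; the bounds on the degrees only make the sums finite. *)
Definition smul f g : series K n := fun a b =>
  \sum_(c : 'X_{1..n < (mdeg a).+1, (mdeg a).+1} | a == (c.1 + c.2)%MM)
  \sum_(d : 'X_{1..n < (mdeg b).+1, (mdeg b).+1} | b == (d.1 + d.2)%MM)
    f c.1 d.1 * g c.2 d.2.

Definition dx (j : 'I_n) f : series K n :=
  fun a b => (a j).+1%:R * f (a + U_(j))%MM b.

Definition dy (j : 'I_n) f : series K n :=
  fun a b => (b j).+1%:R * f a (b + U_(j))%MM.

Definition poisson F G : series K n :=
  \sum_(j < n) (smul (dy j F) (dx j G) - smul (dx j F) (dy j G)).

(* <a - b, lam> *)
Definition pairing lam a b : K := \sum_(j < n) ((a j)%:R - (b j)%:R) * lam j.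

Definition opA lam f : series K n :=
  fun a b => if pairing lam a b == 0 then f a b else 0.

Definition opB lam f : series K n :=
  fun a b => if pairing lam a b != 0 then f a b / pairing lam a b else 0.

(* sum_j lam_j x_j y_j *)
Definition H2 lam : series K n :=
  fun a b => \sum_(j < n) if (a == U_(j)%MM) && (b == U_(j)%MM) then lam j else 0.

(* [sum_k u k = f] in the formal sense: every coefficient of the partial sums
   is eventually equal to that of f. *)
Definition formal_sum (u : nat -> series K n) f :=
  forall a b, exists k0, forall k, (k0 <= k)%N -> \sum_(i < k) u i a b = f a b.

(* [is_exp_ad F H G] : G = e^{F,.} H *)
Definition is_exp_ad F H G :=
  formal_sum (fun k => k`!%:R^-1 *: iter k (poisson F) H) G.

(* [N] is the whole normal form H_2 + N_3 + N_4 + ... of [H]. *)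
Definition is_normal_form lam H N := exists F,
  [/\ in_F F, opA lam F = 0, is_exp_ad F H N,
      in_F (N - H2 lam) & opA lam (N - H2 lam) = N - H2 lam].

(* An s-linear operator is represented by a function on lists of series, of
   which only the values on lists of length s matter. *)
Definition oper := seq (series K n) -> series K n.

Definition oper_id : oper := fun Gs => nth 0 Gs 0.

(* {P, R}, where s is the number of arguments of P. *)
Definition oper_poisson (s : nat) (P R : oper) : oper :=
  fun Gs => poisson (P (take s Gs)) (R (drop s Gs)).

(* {B L_(s_1), {B L_(s_2), ... {B L_(s_k), R} ... }} for ss = [s_1; ...; s_k] *)
Fixpoint nested lam (L : nat -> oper) (ss : seq nat) (R : oper) : oper :=
  if ss is s :: ss' then
    oper_poisson s (fun Gs => opB lam (L s Gs)) (nested lam L ss' R)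
  else R.

(* The k-tuples of integers >= l with sum m; see mem_compositions. *)
Definition compositions (l k m : nat) : seq (seq nat) :=
  [seq ss <- [seq [seq val i | i <- val c] | c : k.-tuple 'I_m.+1]
         | all (leq l) ss & sumn ss == m].

(* The upper bound k < s is automatic, the s_i being >= 1. *)
Definition Lambda_step lam (L : nat -> oper) (s : nat) : oper :=
  if (s <= 1)%N then oper_id else fun Gs =>
    \sum_(1 <= k < s) k`!%:R^-1 *:
      \sum_(ss <- compositions 1 k s.-1) nested lam L ss oper_id Gs
  + \sum_(1 <= k < s) k.+1`!%:R^-1 *:
      \sum_(ss <- compositions 1 k.+1 s)
        nested lam L (take k ss)
          (fun Gs' => let G := L (nth 0%N ss k) Gs' in opA lam G - G) Gs.

(* Recursion on fuel; Lambda1 and LambdaE below give the actual equations. *)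
Fixpoint Lambda_fuel lam (fuel s : nat) : oper :=
  if fuel is fuel'.+1 then Lambda_step lam (Lambda_fuel lam fuel') s
  else oper_id.

Definition Lambda lam (s : nat) : oper := Lambda_fuel lam s s.

Lemma mem_compositions l k m (ss : seq nat) :
  (ss \in compositions l k m) = [&& size ss == k, all (leq l) ss & sumn ss == m].
Proof.
rewrite mem_filter andbC; apply/andP/and3P => [[/imageP[c _ ->] /andP[hl hm]] | ].
  by rewrite hl hm size_map size_tuple eqxx.
move=> [/eqP sz hl hm]; split; last exact/andP.
have hb i : i \in ss -> (i < m.+1)%N.
  rewrite ltnS -(eqP hm) => /path.splitPr[p q].
  by rewrite sumn_cat /= addnCA leq_addr.
have e : [seq val i | i <- [seq inord i : 'I_m.+1 | i <- ss]] = ss.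
  by rewrite -map_comp map_id_in // => i /hb /inordK.
have hs : size [seq inord i : 'I_m.+1 | i <- ss] == k by rewrite size_map sz.
by apply/imageP; exists (Tuple hs); rewrite //= e.
Qed.

Lemma compositions_uniq l k m : uniq (compositions l k m).
Proof.
apply/filter_uniq; rewrite map_inj_uniq ?enum_uniq // => c d.
by move=> /(inj_map val_inj) /val_inj.
Qed.

Lemma Lambda1 lam : Lambda lam 1 = oper_id.
Proof. by []. Qed.

Lemma nested_ext lam (L L' : nat -> oper) (ss : seq nat) (R R' : oper) :
  (forall s, s \in ss -> L s =1 L' s) -> R =1 R' ->
  nested lam L ss R =1 nested lam L' ss R'.
Proof.
move=> hL hR; elim: ss hL => [|s ss IH] hL Gs //=.
rewrite /oper_poisson hL ?mem_head // IH // => t ht.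
by apply: hL; rewrite inE ht orbT.
Qed.

Lemma Lambda_step_ext lam (L L' : nat -> oper) s :
  (forall t, (0 < t < s)%N -> L t =1 L' t) ->
  Lambda_step lam L s =1 Lambda_step lam L' s.
Proof.
move=> hL Gs; rewrite /Lambda_step; case: ltnP => // s1.
have part_gt0 l k m ss t : ss \in compositions l.+1 k m -> t \in ss -> (0 < t)%N.
  by rewrite mem_compositions => /and3P[_ /allP h _] /h; apply: leq_trans.
congr (_ + _); apply: eq_big_nat => k /andP[k0 ks]; congr (_ *: _);
  rewrite big_seq [RHS]big_seq; apply: eq_bigr => ss hss.
  apply: nested_ext => // t ht; apply: hL; rewrite (part_gt0 _ _ _ _ _ hss ht) /=.
  move: hss; rewrite mem_compositions => /and3P[_ _ /eqP hm].
  rewrite -(prednK (ltnW s1)) ltnS -hm.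
  by case/path.splitPr: ht => p q; rewrite sumn_cat /= addnCA leq_addr.
have hlt t : t \in ss -> L t =1 L' t.
  move=> ht; apply: hL; rewrite (part_gt0 _ _ _ _ _ hss ht) /=.
  move: (hss); rewrite mem_compositions => /and3P[/eqP sz _ /eqP hm].
  case/path.splitPr: ht hss sz hm => p q hss sz <-.
  rewrite sumn_cat /= addnCA -{1}[t]addn0 ltn_add2l -sumn_cat.
  have : (0 < size (p ++ q))%N by move: sz k0; rewrite !size_cat /= addnS => -[->].
  have : all (leq 1) (p ++ q).
    by move: hss; rewrite mem_compositions => /and3P[_];
       rewrite !all_cat /= => /and3P[-> _ ->].
  by case: (p ++ q) => //= u r /andP[u0 _] _; rewrite addn_gt0 u0.
apply: nested_ext => [t ht|Gs']; first exact/hlt/(mem_take ht).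
rewrite /= hlt // mem_nth //.
by move: hss; rewrite mem_compositions => /and3P[/eqP -> _ _].
Qed.

Lemma Lambda_fuelE lam fuel s :
  (s <= fuel)%N -> Lambda_fuel lam fuel s =1 Lambda lam s.
Proof.
elim/ltn_ind: s fuel => -[|s] IH [|fuel] //= hs.
rewrite /Lambda /=; apply: Lambda_step_ext => t /andP[t0 ts] Gs.
by rewrite (IH t ts fuel (leq_trans ts hs)) (IH t ts s ts).
Qed.

Lemma LambdaE lam s : Lambda lam s =1 Lambda_step lam (Lambda lam) s.
Proof.
case: s => // s Gs; rewrite {1}/Lambda /=.
by apply: Lambda_step_ext => t /andP[_ ts]; apply: Lambda_fuelE.
Qed.

End Series.

(* Main.v *)
(* Put X = H - H_2, D = multiplication by <a - b, lam>, N_* = N - H_2, and let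
   e^{F,.} bring H to its normal form. Since {F, H_2} = - D F, the series
   G = N_* + D F satisfies A G = N_*, B G = F and
     G = sum_{k >= 0} 1/k! ad_{BG}^k X + sum_{k >= 1} 1/(k+1)! ad_{BG}^k (A - I) G.
   The degree minus 2 ("weight") is a grading for the bracket and X has positive
   weights, so this equation determines G weight by weight. The recursion
   defining Lambda_s is the part of arity s of the same equation, for the
   bracket of series graded by the arity; hence
   sum_s Lambda_s(X, ..., X) solves the equation and equals G, and N_* = A G. *)

Require Import Defs.
From HB Require Import structures.
From mathcomp Require Import all_boot all_order all_algebra.
From mathcomp Require Import mpoly.
From mathcomp Require Import boolp functions reals complex.

Set Implicit Arguments.
Unset Strict Implicit.
Unset Printing Implicit Defensive.

Import GRing.Theory.

Local Open Scope ring_scope.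

(** * Sums over compositions *)

Section Sums.
Variable V : nmodType.

Lemma sum_ord_trunc (F : nat -> V) p q :
  (p <= q)%N -> (forall i, (p <= i < q)%N -> F i = 0) ->
  \sum_(i < q) F i = \sum_(i < p) F i.
Proof.
move=> pq F0; rewrite -!(big_mkord xpredT F) (@big_cat_nat _ _ _ p) //=.
rewrite [X in _ + X]big_nat_cond [X in _ + X]big1 ?addr0 // => i.
by rewrite andbT; apply: F0.
Qed.

Lemma sum_triangle (X : nat -> nat -> V) m :
  \sum_(a < m.+1) \sum_(i < a.+1) X i (a - i)%N =
  \sum_(i < m.+1) \sum_(j < (m - i).+1) X i j.
Proof.
elim: m => [|m IH]; first by rewrite !big_ord1.
rewrite big_ord_recr IH /= [RHS]big_ord_recr /= subnn big_ord1.
rewrite [X in _ + X]big_ord_recr /= subnn addrA; congr (_ + _).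
rewrite -big_split; apply: eq_bigr => i _ /=.
by rewrite subSn -1?ltnS // [RHS]big_ord_recr.
Qed.

(** Both sides sum over duplicate-free lists with the same members, so they agree up to a
    permutation. *)
Lemma sum_compositions_cons l k m (f : seq nat -> V) :
  \sum_(ss <- compositions l k.+1 m) f ss =
  \sum_(i < m.+1 | (l <= i)%N)
    \sum_(ss <- compositions l k (m - i)) f (nat_of_ord i :: ss).
Proof.
rewrite -(big_mkord (leq l)
  (fun i : nat => \sum_(ss <- compositions l k (m - i)) f (i :: ss))).
rewrite -big_filter.
rewrite -(@big_allpairs_dep _ _ _ _ _ _ (fun (i : nat) (ss : seq nat) => i :: ss) _ _ f).
apply/perm_big/uniq_perm.
- exact: compositions_uniq.
- apply: allpairs_uniq_dep => [|i _|].
  + exact/filter_uniq/iota_uniq.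
  + exact: compositions_uniq.
  + by move=> [i s] [j t] _ _ /= [-> ->].
move=> ss; rewrite mem_compositions; apply/and3P/allpairsPdep.
  case: ss => [[]//|i ss] [sz /andP[li h] /eqP <-]; exists i, ss.
  rewrite [sumn _]/=.
  rewrite mem_compositions mem_filter li mem_iota subn0 add0n ltnS leq_addr.
  by rewrite addKn (h : all (leq l) ss) -eqSS (sz : _.+1 == _) eqxx.
move=> [i [s [+ + ->]]]; rewrite mem_compositions mem_filter mem_iota /= add0n subn0 ltnS.
move=> /andP[-> im] /and3P[/eqP-> -> /eqP->].
by rewrite subnKC // !eqxx.
Qed.

Lemma sum_compositions0 l m (f : seq nat -> V) :
  \sum_(ss <- compositions l 0 m) f ss = if m == 0%N then f [::] else 0.
Proof.
case: eqP => [->|/eqP m0].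
  rewrite (perm_big [:: [::]]) ?big_seq1 //; apply: uniq_perm => //.
    exact: compositions_uniq.
  by move=> [|i ss]; rewrite mem_compositions inE.
rewrite big_seq big1 // => -[|i ss]; rewrite mem_compositions //= eq_sym.
by rewrite (negbTE m0).
Qed.

Lemma sum_compositions1 l m (f : seq nat -> V) :
  \sum_(ss <- compositions l 1 m) f ss = if (l <= m)%N then f [:: m] else 0.
Proof.
rewrite sum_compositions_cons big_mkcond.
under eq_bigr do rewrite sum_compositions0.
rewrite big_ord_recr big1 => [|i _] /=; first by rewrite subnn add0r.
by rewrite subn_eq0 [(m <= i)%N]leqNgt ltn_ord if_same.
Qed.

(** This distributes the arguments of a bracket between its two operators: the first [k] parts go
    left, the others right. *)
Lemma sum_compositions_cat l k k' m (f : seq nat -> V) :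
  \sum_(ss <- compositions l (k + k') m) f ss =
  \sum_(a < m.+1) \sum_(p <- compositions l k a)
    \sum_(q <- compositions l k' (m - a)) f (p ++ q).
Proof.
elim: k m f => [|k IH] m f.
  rewrite (@sum_ord_trunc (fun a => \sum_(p <- compositions l 0 a)
    \sum_(q <- compositions l k' (m - a)) f (p ++ q)) 1 m.+1) //.
    by rewrite big_ord1 sum_compositions0 eqxx subn0 add0n.
  by move=> [//|i] _; rewrite sum_compositions0.
rewrite addSn sum_compositions_cons.
under eq_bigr do rewrite IH /=.
under [RHS]eq_bigr => a _.
  rewrite sum_compositions_cons big_mkcond.
  under eq_bigr => i _.
    (* The summand now depends on [a] only through [a - i], the shape that [sum_triangle]
       reindexes. *)
    rewrite (_ : (m - a = m - i - (a - i))%N); last first.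
      by rewrite -subnDA subnKC // -ltnS.
    over.
  over.
rewrite (@sum_triangle (fun i j => if (l <= i)%N then \sum_(p <- compositions l k j)
  \sum_(q <- compositions l k' (m - i - j)) f ((i :: p) ++ q) else 0)).
rewrite big_mkcond; apply: eq_bigr => i _; case: ifP => // _.
by rewrite big1.
Qed.

(** Converts the degrees at least 3 of the final formula into weights at least 1: each of the [k]
    parts loses 2. *)
Lemma sum_compositions_shift k w (f : seq nat -> V) :
  \sum_(ss <- compositions 3 k (w + 2 * k)) f ss =
  \sum_(ss <- compositions 1 k w) f [seq (i + 2)%N | i <- ss].
Proof.
rewrite -(big_map (map (addn^~ 2%N)) xpredT f); apply/perm_big/uniq_perm.
- exact: compositions_uniq.
- rewrite map_inj_uniq ?compositions_uniq //.
  exact/inj_map/addIn.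
have sumD s : sumn [seq (i + 2)%N | i <- s] = (sumn s + 2 * size s)%N.
  by elim: s => //= i s ->; rewrite mulnS addnACA.
move=> ss; rewrite mem_compositions; apply/and3P/mapP => [[/eqP sz h /eqP sm]|].
  exists [seq (i - 2)%N | i <- ss].
    rewrite mem_compositions size_map sz eqxx all_map /=.
    rewrite (sub_all _ h) => [|i]; last by rewrite /= subn_gt0.
    have := sumD [seq (i - 2)%N | i <- ss].
    rewrite size_map sz -map_comp map_id_in ?sm; last first.
      by move=> i /(allP h) /ltnW i2; rewrite /= subnK.
    by move=> /eqP; rewrite eqn_add2r eq_sym.
  rewrite -map_comp map_id_in // => i /(allP h) /ltnW i2; by rewrite /= subnK.
move=> [s]; rewrite mem_compositions => /and3P[/eqP sz h /eqP sm] ->.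
rewrite size_map sz sumD sm sz !eqxx all_map; split=> //.
by apply: sub_all h => i; rewrite /= addn2.
Qed.

End Sums.

(** * Convolution of graded sequences *)

(** The bracket is abstract because it is instantiated twice: by [poisson], for series graded by
    weight, and by [conv poisson], for families graded by arity whose members are graded by
    weight. *)
Definition biadditive (V : zmodType) (br : V -> V -> V) :=
  (forall z, {morph br^~ z : x y / x + y}) /\
  (forall z, {morph br z : x y / x + y}).

Definition conv (V : zmodType) (br : V -> V -> V) (U Y : nat -> V) : nat -> V :=
  fun w => \sum_(i < w.+1) br (U i) (Y (w - i)%N).

(** Unfolds only the outer layer of a nested [conv (conv br)]. *)
Lemma convE (V : zmodType) (br : V -> V -> V) U Y w :
  conv br U Y w = \sum_(i < w.+1) br (U i) (Y (w - i)%N).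
Proof. by []. Qed.

Section Conv.
Variables (V : zmodType) (br : V -> V -> V).
Hypothesis br_add : biadditive br.

Lemma biadd0l z : br 0 z = 0.
Proof. by apply: (addrI (br 0 z)); rewrite -(br_add.1 z) !addr0. Qed.

Lemma biadd0r z : br z 0 = 0.
Proof. by apply: (addrI (br z 0)); rewrite -(br_add.2 z) !addr0. Qed.

Lemma biadd_suml I (r : seq I) (P : pred I) F z :
  br (\sum_(i <- r | P i) F i) z = \sum_(i <- r | P i) br (F i) z.
Proof. exact: (big_morph (br^~ z) (br_add.1 z) (biadd0l z)). Qed.

Lemma biadd_sumr I (r : seq I) (P : pred I) F z :
  br z (\sum_(i <- r | P i) F i) = \sum_(i <- r | P i) br z (F i).
Proof. exact: (big_morph (br z) (br_add.2 z) (biadd0r z)). Qed.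

Lemma conv_biadditive : biadditive (conv br).
Proof.
split=> Z X Y; apply/funext => w; rewrite /conv [RHS]/GRing.add /= -big_split /=;
  by apply: eq_bigr => i _; rewrite (br_add.1, br_add.2).
Qed.

Lemma iter_biaddD k U : {morph iter k (br U) : x y / x + y}.
Proof. by move=> x y; elim: k => //= k ->; rewrite br_add.2. Qed.

(** [Y] starts in degree 1 and each bracket with [U] raises the degree by at least 1. This is what
    makes every exponential series below finite. *)
Lemma iter_conv_lt U Y k w : U 0%N = 0 -> Y 0%N = 0 -> (w <= k)%N ->
  iter k (conv br U) Y w = 0.
Proof.
move=> U0 Y0; elim: k w => [|k IH] w; first by rewrite leqn0 => /eqP ->.
move=> wk; rewrite /= /conv big1 // => -[[|i] /= _] _; first by rewrite U0 biadd0l.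
by rewrite IH ?biadd0r // leq_subLR (leq_trans wk) // addSn ltnS leq_addl.
Qed.

(** A factor of degree [w] would be paired with one of degree 0, which vanishes; so both factors
    have degree below [w]. *)
Lemma conv_local U U' Y Y' w :
  U 0%N = 0 -> U' 0%N = 0 -> Y 0%N = 0 -> Y' 0%N = 0 ->
  (forall v, (v < w)%N -> U v = U' v) -> (forall v, (v < w)%N -> Y v = Y' v) ->
  conv br U Y w = conv br U' Y' w.
Proof.
move=> U0 U'0 Y0 Y'0 UU' YY'; apply: eq_bigr => -[[|i] /=]; rewrite ltnS => iw _.
  by rewrite U0 U'0 !biadd0l.
have [iw'|] := ltnP i.+1 w; last first.
  by move=> wi; rewrite (_ : (w - i.+1 = 0)%N) ?Y0 ?Y'0 ?biadd0r //; apply/eqP.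
by rewrite UU' // YY' // ltn_subrL (leq_trans _ iw).
Qed.

Lemma iter_conv_local U U' Y Y' w k :
  U 0%N = 0 -> U' 0%N = 0 -> Y 0%N = 0 -> Y' 0%N = 0 ->
  (forall v, (v < w)%N -> U v = U' v) -> (forall v, (v < w)%N -> Y v = Y' v) ->
  forall v, (v < w)%N -> iter k (conv br U) Y v = iter k (conv br U') Y' v.
Proof.
move=> U0 U'0 Y0 Y'0 UU' YY'; elim: k => [|k IH] v vw //=; first exact: YY'.
have lt_trans u : (u < v)%N -> (u < w)%N by move/ltn_trans; apply.
apply: conv_local => //; [exact: iter_conv_lt | exact: iter_conv_lt | |].
- by move=> u /lt_trans; apply: UU'.
- by move=> u /lt_trans; apply: IH.
Qed.

(** The first index is the arity, the second the weight. For [supported] families the terms with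
    [s > w] vanish, so the truncated sum is the sum over all arities. *)
Definition total_parts (U : nat -> nat -> V) : nat -> V := fun w => \sum_(s < w.+1) U s w.

Definition supported (U : nat -> nat -> V) := forall s w, (w < s)%N -> U s w = 0.

Lemma conv_supported U Y :
  supported U -> supported Y -> supported (conv (conv br) U Y).
Proof.
move=> hU hY s w ws; rewrite /conv fct_sumE big1 // => i _; rewrite big1 // => v _.
have [vi|iv] := ltnP v i; first by rewrite hU // biadd0l.
rewrite [Y _ _]hY ?biadd0r //; apply: leq_ltn_trans (leq_sub2l w iv) _.
by rewrite ltn_sub2r // (leq_ltn_trans iv) // (leq_trans (ltn_ord v)).
Qed.

(** Forgetting the arity is a morphism of brackets. After [sum_triangle] the two arities range
    independently of how weight is shared, and the support condition cuts them to the ranges of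
    [total_parts]. *)
Lemma total_conv U Y : supported U -> supported Y ->
  total_parts (conv (conv br) U Y) = conv br (total_parts U) (total_parts Y).
Proof.
move=> hU hY; apply/funext => w; rewrite /total_parts /conv.
under eq_bigr do rewrite fct_sumE exchange_big /=.
under eq_bigr do rewrite exchange_big /=.
rewrite (@sum_triangle _ (fun i j => \sum_(v < w.+1) br (U i v) (Y j (w - v)%N))).
under eq_bigr do rewrite exchange_big /=.
rewrite exchange_big /=; apply: eq_bigr => -[v /=]; rewrite ltnS => vw _.
rewrite biadd_suml (@sum_ord_trunc _ (fun i => \sum_(j < (w - i).+1)
  br (U i v) (Y j (w - v)%N)) v.+1) //; last first.
  by move=> i /andP[vi _]; rewrite big1 // => j _; rewrite hU // biadd0l.
apply: eq_bigr => -[i /=]; rewrite ltnS => iv _.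
rewrite biadd_sumr (@sum_ord_trunc _ (fun j => br (U i v) (Y j (w - v)%N)) (w - v).+1) //.
  by rewrite ltnS leq_sub2l.
by move=> j /andP[vj _]; rewrite hY // biadd0r.
Qed.

Lemma iter_conv_supported U Y k :
  supported U -> supported Y -> supported (iter k (conv (conv br) U) Y).
Proof. by move=> hU hY; elim: k => //= k; apply: conv_supported. Qed.

Lemma total_iter_conv U Y k : supported U -> supported Y ->
  total_parts (iter k (conv (conv br) U) Y) =
  iter k (conv br (total_parts U)) (total_parts Y).
Proof.
move=> hU hY; elim: k => //= k <-.
by rewrite total_conv //; apply: iter_conv_supported.
Qed.

End Conv.

(** * The fixed-point equation, solved degree by degree *)

Section Recursion.
Variables (K : fieldType) (c d : nat -> K).

(** The component of index [w] of the equation for G, with U = BG and Y = (A - I)G. The bound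
    [k < w] loses nothing, by [iter_conv_lt]. *)
Definition recursion (V : lmodType K) (br : V -> V -> V) (U X Y : nat -> V)
    (w : nat) : V :=
  \sum_(0 <= k < w) c k *: iter k (conv br U) X w +
  \sum_(1 <= k < w) d k *: iter k (conv br U) Y w.

Section Unique.
Variables (V : lmodType K) (br : V -> V -> V).
Hypothesis br_add : biadditive br.
Variables (B C : V -> V) (X : nat -> V).
Hypotheses (B0 : B 0 = 0) (C0 : C 0 = 0) (X0 : X 0%N = 0).

(** The only term without a bracket is the [k = 0] term of the first sum, which involves the common
    [X]. Every other term contains a bracket with [B \o G], hence depends only on components of [G]
    below [w], and strong induction applies. *)
Lemma recursion_unique G G' :
  G =1 recursion br (B \o G) X (C \o G) ->
  G' =1 recursion br (B \o G') X (C \o G') -> G =1 G'.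
Proof.
move=> hG hG'.
have Z0 G1 : G1 =1 recursion br (B \o G1) X (C \o G1) -> G1 0%N = 0.
  by move=> ->; rewrite /recursion !big_geq // addr0.
elim/ltn_ind => -[|w] IH; first by rewrite !Z0.
rewrite hG hG' /recursion.
have eqB v : (v < w.+1)%N -> (B \o G) v = (B \o G') v by move=> vw; rewrite /= IH.
have eqC v : (v < w.+1)%N -> (C \o G) v = (C \o G') v by move=> vw; rewrite /= IH.
have [BG BG'] : (B \o G) 0%N = 0 /\ (B \o G') 0%N = 0 by rewrite /= !Z0.
have [CG CG'] : (C \o G) 0%N = 0 /\ (C \o G') 0%N = 0 by rewrite /= !Z0.
congr (_ + _); apply: eq_big_nat => -[|k] // _; congr (_ *: _); rewrite 2!iterS.
  apply: conv_local => // [||v vw]; [exact: iter_conv_lt | exact: iter_conv_lt |].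
  exact: (@iter_conv_local _ _ br_add _ _ _ _ w.+1).
apply: conv_local => // [||v vw]; [exact: iter_conv_lt | exact: iter_conv_lt |].
  exact: (@iter_conv_local _ _ br_add _ _ _ _ w.+1).
Qed.

End Unique.

(** Passes from the equation graded by arity to the one graded by weight, using that [total_parts]
    commutes with iterated brackets. *)
Lemma total_recursion (V : lmodType K) (br : V -> V -> V)
    (T U X Y : nat -> nat -> V) :
  biadditive br -> supported U -> supported X -> supported Y ->
  U 0%N = 0 -> X 0%N = 0 -> Y 0%N = 0 ->
  T =1 recursion (conv br) U X Y ->
  total_parts T =1 recursion br (total_parts U) (total_parts X) (total_parts Y).
Proof.
move=> br_add sU sX sY U0 X0 Y0 hT w; rewrite /recursion.
under eq_bigr do rewrite -total_iter_conv // scaler_sumr.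
under [X in _ + X]eq_bigr do rewrite -total_iter_conv // scaler_sumr.
rewrite exchange_big [X in _ + X]exchange_big -big_split /=.
apply: eq_bigr => -[s /=]; rewrite ltnS => sw _.
have ge_eq0 Z k : Z 0%N = 0 -> (s <= k)%N -> iter k (conv (conv br) U) Z s w = 0.
  move=> Z0 sk; rewrite iter_conv_lt //; exact: conv_biadditive.
(* The arity equation stops at [k < s], the weight equation at [k < w]; in arity [s] the terms in
   between vanish. *)
have trunc Z e p : (p <= 1)%N -> Z 0%N = 0 ->
    \sum_(p <= k < s) e k *: iter k (conv (conv br) U) Z s w =
    \sum_(p <= k < w) e k *: iter k (conv (conv br) U) Z s w.
  move=> p1 Z0; case: s sw ge_eq0 => [|s] sw ge_eq0.
    by rewrite big_geq // big1 // => k _; rewrite ge_eq0 // scaler0.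
  rewrite [RHS](@big_cat_nat _ _ _ s.+1) //=; last exact: leq_trans p1 _.
  rewrite [X in _ + X]big_nat_cond [X in _ + X]big1 ?addr0 // => k.
  by rewrite andbT => /andP[sk _]; rewrite ge_eq0 // scaler0.
by rewrite hT /recursion -!trunc // [LHS]/GRing.add /= !fct_sumE.
Qed.

End Recursion.

(** * The operators on series and their homogeneous parts *)

Section SeriesTheory.
Variables (K : fieldType) (n : nat).
Implicit Types (f g F G H N X : series K n) (a b : 'X_{1..n}) (lam : 'I_n -> K).

Lemma seriesDE f g a b : (f + g) a b = f a b + g a b. Proof. by []. Qed.

Lemma seriesNE f a b : (- f) a b = - f a b. Proof. by []. Qed.

Lemma seriesZE (c : K) f a b : (c *: f) a b = c * f a b. Proof. by []. Qed.

Lemma smul_biadditive : biadditive (@smul K n).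
Proof.
split=> z f g; apply/funext => a; apply/funext => b; rewrite seriesDE /smul;
  rewrite -big_split; apply: eq_bigr => c _ /=;
  rewrite -big_split; apply: eq_bigr => d _ /=;
  by rewrite (mulrDl, mulrDr).
Qed.

Lemma dxD j : {morph @dx K n j : f g / f + g}.
Proof.
move=> f g; apply/funext => a; apply/funext => b.
by rewrite seriesDE /dx seriesDE mulrDr.
Qed.

Lemma dyD j : {morph @dy K n j : f g / f + g}.
Proof.
move=> f g; apply/funext => a; apply/funext => b.
by rewrite seriesDE /dy seriesDE mulrDr.
Qed.

Lemma poisson_biadditive : biadditive (@poisson K n).
Proof.
have [sl sr] := smul_biadditive.
split=> z f g; rewrite /poisson -big_split; apply: eq_bigr => j _ /=;
  by rewrite !(dxD, dyD) !(sl, sr) opprD addrACA.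
Qed.

Lemma opAD lam : {morph @opA K n lam : f g / f + g}.
Proof.
move=> f g; apply/funext => a; apply/funext => b.
by rewrite seriesDE /opA seriesDE; case: ifP; rewrite ?addr0.
Qed.

Lemma opBD lam : {morph @opB K n lam : f g / f + g}.
Proof.
move=> f g; apply/funext => a; apply/funext => b.
by rewrite seriesDE /opB seriesDE; case: ifP; rewrite ?addr0 ?mulrDl.
Qed.

Lemma opA0 lam : opA lam (0 : series K n) = 0.
Proof. by apply/funext => a; apply/funext => b; rewrite /opA if_same. Qed.

Lemma opB0 lam : opB lam (0 : series K n) = 0.
Proof.
by apply/funext => a; apply/funext => b; rewrite /opB [X in X / _]/0 /= mul0r if_same.
Qed.

Lemma opA_sum lam I (r : seq I) (P : pred I) (f : I -> series K n) :
  opA lam (\sum_(i <- r | P i) f i) = \sum_(i <- r | P i) opA lam (f i).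
Proof. exact: (big_morph _ (opAD lam) (opA0 lam)). Qed.

Lemma opB_sum lam I (r : seq I) (P : pred I) (f : I -> series K n) :
  opB lam (\sum_(i <- r | P i) f i) = \sum_(i <- r | P i) opB lam (f i).
Proof. exact: (big_morph _ (opBD lam) (opB0 lam)). Qed.

Lemma hpartD m : {morph @hpart K n m : f g / f + g}.
Proof.
move=> f g; apply/funext => a; apply/funext => b.
by rewrite seriesDE /hpart seriesDE; case: ifP; rewrite ?addr0.
Qed.

Lemma hpart0 m : hpart m (0 : series K n) = 0.
Proof. by apply/funext => a; apply/funext => b; rewrite /hpart if_same. Qed.

Lemma hpartN m f : hpart m (- f) = - hpart m f.
Proof. by apply: (addrI (hpart m f)); rewrite -hpartD !subrr hpart0. Qed.

Lemma hpartZ m (c : K) f : hpart m (c *: f) = c *: hpart m f.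
Proof.
apply/funext => a; apply/funext => b; rewrite seriesZE /hpart seriesZE.
by case: ifP; rewrite // mulr0.
Qed.

Lemma hpart_sum m I (r : seq I) (P : pred I) (f : I -> series K n) :
  hpart m (\sum_(i <- r | P i) f i) = \sum_(i <- r | P i) hpart m (f i).
Proof. exact: (big_morph _ (hpartD m) (hpart0 m)). Qed.

Lemma hpart_opA lam m f : hpart m (opA lam f) = opA lam (hpart m f).
Proof.
by apply/funext => a; apply/funext => b; rewrite /hpart /opA; do 2!case: ifP.
Qed.

Lemma hpart_opB lam m f : hpart m (opB lam f) = opB lam (hpart m f).
Proof.
apply/funext => a; apply/funext => b; rewrite /hpart /opB.
by do 2!case: ifP => //; rewrite mul0r.
Qed.

Lemma in_F_hpart f : in_F f <-> forall m, (m < 3)%N -> hpart m f = 0.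
Proof.
split=> h => [m m3|a b /h]; last first.
  by move/(congr1 (fun g => g a b)); rewrite /hpart eqxx.
apply/funext => a; apply/funext => b; rewrite /hpart.
by case: eqP => // ab; rewrite h // ab.
Qed.

Lemma hpart_smul m f g :
  hpart m (smul f g) = \sum_(i < m.+1) smul (hpart i f) (hpart (m - i) g).
Proof.
apply/funext => a; apply/funext => b; rewrite !fct_sumE /smul.
rewrite exchange_big /=; under eq_bigr do rewrite exchange_big /=.
have degD (c : 'X_{1..n < (mdeg a).+1, (mdeg a).+1})
    (d : 'X_{1..n < (mdeg b).+1, (mdeg b).+1}) :
    a == (c.1 + c.2)%MM -> b == (d.1 + d.2)%MM ->
    (mdeg a + mdeg b = mdeg c.1 + mdeg d.1 + (mdeg c.2 + mdeg d.2))%N.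
  move=> /eqP ca /eqP db; rewrite addnACA -(mdegD c.1) -(mdegD d.1).
  by congr addn; [exact: congr1 ca | exact: congr1 db].
rewrite /hpart; case: ifPn => [/eqP ab|ab].
  apply: eq_bigr => c ca; apply: eq_bigr => d db; have e := degD c d ca db.
  have le_i : (mdeg c.1 + mdeg d.1 < m.+1)%N by rewrite ltnS -ab e leq_addr.
  rewrite (bigD1 (Ordinal le_i)) //= eqxx.
  rewrite (_ : m - _ = mdeg c.2 + mdeg d.2)%N; last by rewrite -ab e addKn.
  rewrite eqxx big1 ?addr0 // => i /eqP ne; case: eqP => [ei|_]; last by rewrite mul0r.
  by case: ne; apply: val_inj.
rewrite big1 // => c ca; rewrite big1 // => d db; rewrite big1 // => i _.
case: eqP => [e1|]; last by rewrite mul0r.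
case: eqP => [e2|]; last by rewrite mulr0.
case/eqP: ab; rewrite (degD c d ca db) e1 e2 subnKC // -ltnS; exact: ltn_ord.
Qed.

Lemma hpart_dx j m f : hpart m (dx j f) = dx j (hpart m.+1 f).
Proof.
apply/funext => a; apply/funext => b; rewrite /hpart /dx.
by rewrite mdegD mdeg1 addn1 addSn eqSS; case: ifP; rewrite ?mulr0.
Qed.

Lemma hpart_dy j m f : hpart m (dy j f) = dy j (hpart m.+1 f).
Proof.
apply/funext => a; apply/funext => b; rewrite /hpart /dy.
by rewrite mdegD mdeg1 addn1 addnS eqSS; case: ifP; rewrite ?mulr0.
Qed.

(** Each derivative lowers the degree by one, hence the successors. *)
Lemma hpart_poisson m F G :
  hpart m (poisson F G) =
  \sum_(i < m.+1) poisson (hpart i.+1 F) (hpart (m - i).+1 G).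
Proof.
rewrite /poisson hpart_sum exchange_big; apply: eq_bigr => j _ /=.
rewrite hpartD hpartN !hpart_smul -sumrB; apply: eq_bigr => i _.
by rewrite !hpart_dx !hpart_dy.
Qed.

Lemma in_F_poisson F G : in_F F -> in_F G -> in_F (poisson F G).
Proof.
move=> /in_F_hpart hF /in_F_hpart hG; apply/in_F_hpart => m m3.
rewrite hpart_poisson big1 // => i _; have [i2|i2] := ltnP i 2.
  by rewrite hF // biadd0l //; apply: poisson_biadditive.
rewrite hG ?biadd0r //; first exact: poisson_biadditive.
by rewrite !ltnS leq_subLR (leq_trans (m3 : m <= 2)%N) // (leq_trans i2) // leq_addr.
Qed.

(* The bracket of forms of degrees i + 2 and j + 2 has degree i + j + 2, so the
   degree shifted by 2 is a grading for the bracket. *)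
Definition wpart f (w : nat) : series K n := hpart (w + 2) f.

Lemma wpart0 f : in_F f -> wpart f 0 = 0.
Proof. by move/in_F_hpart => h; rewrite /wpart h. Qed.

Lemma wpart_poisson F G : in_F F -> in_F G ->
  wpart (poisson F G) = conv (@poisson K n) (wpart F) (wpart G).
Proof.
move=> /in_F_hpart hF /in_F_hpart hG; have pb := poisson_biadditive.
apply/funext => w; rewrite /wpart /conv hpart_poisson addn2.
(* The two extreme terms contain a form of degree 1, which is zero in [in_F]; the remaining ones are
   exactly the convolution. *)
rewrite big_ord_recl hF // (biadd0l pb) add0r big_ord_recr /=.
rewrite (hG (w.+2 - _).+1) ?(biadd0r pb) ?addr0; last by rewrite /bump /= add1n subnn.
apply: eq_bigr => -[i /=]; rewrite ltnS => iw _.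
by rewrite /bump /= add1n subSS subSn // !addn2.
Qed.

Lemma in_F_iter_poisson F G k : in_F F -> in_F G -> in_F (iter k (poisson F) G).
Proof. by move=> hF hG; elim: k => //= k; apply: in_F_poisson. Qed.

Lemma wpart_iter_poisson F G k : in_F F -> in_F G ->
  wpart (iter k (poisson F) G) = iter k (conv (@poisson K n) (wpart F)) (wpart G).
Proof.
move=> hF hG; elim: k => //= k <-.
by rewrite wpart_poisson //; apply: in_F_iter_poisson.
Qed.

Lemma formal_sum_hpart (u : nat -> series K n) f m p :
  formal_sum u f -> (forall k, (p <= k)%N -> hpart m (u k) = 0) ->
  hpart m f = \sum_(k < p) hpart m (u k).
Proof.
move=> uf u0; apply/funext => a; apply/funext => b; rewrite !fct_sumE /hpart.
case: ifPn => ab; last by rewrite big1.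
(* At [maxn k0 p] the partial sum has already stabilized and contains all nonzero terms. *)
have [k0 /(_ _ (leq_maxl k0 p)) <-] := uf a b.
rewrite (@sum_ord_trunc _ (fun i => u i a b) p) ?leq_maxr // => i /andP[pi _].
by have := congr1 (fun g => g a b) (u0 i pi); rewrite /hpart ab.
Qed.

(** * The diagonal operator D and the bracket with H_2 *)

Definition opD lam f : series K n := fun a b => pairing lam a b * f a b.

Lemma opA_opD lam f : opA lam (opD lam f) = 0.
Proof.
apply/funext => a; apply/funext => b; rewrite /opA /opD.
by case: eqP => // ->; rewrite mul0r.
Qed.

Lemma opB_opD lam f : opB lam (opD lam f) = f - opA lam f.
Proof.
apply/funext => a; apply/funext => b; rewrite /opB /opD seriesDE seriesNE /opA.
by case: eqVneq => [_|ne] /=; rewrite ?subrr // subr0 mulrC mulKf.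
Qed.

Lemma opB_opA lam f : opB lam (opA lam f) = 0.
Proof.
apply/funext => a; apply/funext => b; rewrite /opB /opA.
by case: eqVneq => //= _; rewrite mul0r.
Qed.

Lemma in_F_opD lam f : in_F f -> in_F (opD lam f).
Proof. by move=> h a b ab; rewrite /opD h // mulr0. Qed.

Lemma in_F_opp f : in_F f -> in_F (- f).
Proof. by move=> h a b ab; rewrite seriesNE h // oppr0. Qed.

Lemma in_FD f g : in_F f -> in_F g -> in_F (f + g).
Proof. by move=> hf hg a b ab; rewrite seriesDE hf // hg // addr0. Qed.

(** Of the double Cauchy sum only the splitting with second factor x^p y^q survives. It is applied
    to the derivatives of [H2], which are monomials. *)
Lemma smul_monomial (c : K) (p q : 'X_{1..n}) f a b :
  smul f (fun a' b' => if (a' == p) && (b' == q) then c else 0) a b =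
  if (p <= a)%MM && (q <= b)%MM then f (a - p)%MM (b - q)%MM * c else 0.
Proof.
rewrite /smul; case: ifPn => [/andP[pa qb]|pqab]; last first.
  rewrite big1 // => c1 /eqP e1; rewrite big1 // => d1 /eqP e2.
  case: ifPn => [/andP[/eqP c2 /eqP d2]|_]; last by rewrite mulr0.
  case/negP: pqab; rewrite -c2 -d2.
  by apply/andP; split; [move: (lem_addl c1.1 c1.2) | move: (lem_addl d1.1 d1.2)];
    rewrite -(e1, e2).
have bound (u v : 'X_{1..n}) : (u <= v)%MM ->
    (mdeg u < (mdeg v).+1)%N /\ (mdeg (v - u)%MM < (mdeg v).+1)%N.
  move=> uv; move: (congr1 mdeg (submK uv)); rewrite mdegD !ltnS => <-.
  by split; [apply: leq_addl | apply: leq_addr].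
have [a2 a1] := bound _ _ pa; have [b2 b1] := bound _ _ qb.
rewrite (bigD1 (BMultinom a1, BMultinom a2)) /=; last by rewrite submK.
rewrite [X in _ + X]big1 ?addr0; last first.
  move=> [c1 c2] /= /andP[/eqP e ne]; rewrite big1 // => d _.
  case: eqP => [c2p|]; last by rewrite mulr0.
  case/eqP: ne; congr (_, _); apply: val_inj => //=.
  by apply/esym; move: (congr1 (fun u => u - p)%MM e); rewrite c2p addmK.
rewrite (bigD1 (BMultinom b1, BMultinom b2)) /=; last by rewrite submK.
rewrite !eqxx /= big1 ?addr0 // => -[d1 d2] /= /andP[/eqP e ne].
case: eqP => [d2q|]; last by rewrite mulr0.
case/eqP: ne; congr (_, _); apply: val_inj => //=.
by apply/esym; move: (congr1 (fun u => u - q)%MM e); rewrite d2q addmK.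
Qed.

Lemma dx_H2 lam j : dx j (H2 lam) =
  (fun a b => if (a == 0%MM) && (b == U_(j)%MM) then lam j else 0) :> series K n.
Proof.
apply/funext => a; apply/funext => b; rewrite /dx /H2.
have [->|a0] /= := eqVneq a 0%MM.
  rewrite mnm0E mul1r add0m (bigD1 j) //= eqxx big1 ?addr0 // => i ij.
  case: eqP => //= /(congr1 (fun u : 'X_{1..n} => u i)).
  by rewrite !mnm1E eqxx eq_sym (negbTE ij).
rewrite big1 ?mulr0 // => i _; case: eqP => //= e.
by move/(congr1 mdeg)/eqP: e; rewrite mdegD !mdeg1 addn1 eqSS mdeg_eq0 (negbTE a0).
Qed.

Lemma dy_H2 lam j : dy j (H2 lam) =
  (fun a b => if (a == U_(j)%MM) && (b == 0%MM) then lam j else 0) :> series K n.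
Proof.
(* [H2] is symmetric under the exchange of x and y. *)
have := dx_H2 lam j; rewrite /dx /dy /H2 => h.
apply/funext => a; apply/funext => b.
have := congr1 (fun g => g b a) h; rewrite /= andbC => <-.
by congr (_ * _); apply: eq_bigr => i _; rewrite andbC.
Qed.

Lemma poisson_H2 lam F : poisson F (H2 lam) = - opD lam F.
Proof.
apply/funext => a; apply/funext => b.
rewrite /poisson !fct_sumE seriesNE /opD /pairing mulr_suml -sumrN.
apply: eq_bigr => j _; rewrite seriesDE seriesNE.
have le0m (e : 'X_{1..n}) : (0 <= e)%MM by apply/mnm_lepP => i; rewrite mnm0E.
rewrite dx_H2 dy_H2 !smul_monomial /dx /dy !le0m !subm0 !andbT /=.
(* Differentiating in a variable and multiplying by it again scales a monomial by its exponent; both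
   sides vanish when that exponent is 0. *)
have shift (e : 'X_{1..n}) (x : K) (y : 'X_{1..n} -> K) :
    (if (U_(j) <= e)%MM
     then ((e - U_(j))%MM j).+1%:R * y (e - U_(j) + U_(j))%MM * x else 0) =
    (e j)%:R * x * y e.
  rewrite lep1mP; have [->|ej] := eqVneq (e j) 0%N; first by rewrite !mul0r.
  have le : (U_(j) <= e)%MM by rewrite lep1mP.
  rewrite (submK le) mnmBE mnm1E eqxx subn1 prednK ?lt0n //.
  by rewrite mulrAC.
rewrite (shift b _ (F a)) (shift a _ (F^~ b)) !mulrBl opprB.
by [].
Qed.

End SeriesTheory.

(** * The recursion for the normal form *)

Definition inv_fact (K : fieldType) (k : nat) : K := k`!%:R^-1.

Definition inv_factS (K : fieldType) (k : nat) : K := k.+1`!%:R^-1.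

Section NormalForm.
Variables (K : fieldType) (n : nat) (lam : 'I_n -> K).
Implicit Types (F H N : series K n).

(** [H2] absorbs one bracket, which is why 1/(k+1)! accompanies [k] brackets in the second sum. *)
Lemma iter_poisson_H2 F k :
  iter k.+1 (poisson F) (H2 lam) = iter k (poisson F) (- opD lam F).
Proof. by rewrite iterSr poisson_H2. Qed.

(** Split H into X and H_2 in the exponential. The [k = 1] term on H_2 is - D F; moving it to the
    left yields N_* + D F there. *)
Lemma wpart_exp_ad F H N w : in_F F -> in_F (H - H2 lam) ->
  is_exp_ad F H N -> in_F (N - H2 lam) ->
  wpart (N - H2 lam + opD lam F) w =
  recursion (inv_fact K) (inv_factS K) (@poisson K n) (wpart F)
    (wpart (H - H2 lam)) (wpart (- opD lam F)) w.
Proof.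
move=> FF XF FHN NF; have DF := in_F_opp (in_F_opD lam FF).
case: w => [|w]; first by rewrite wpart0 ?/recursion ?big_geq ?addr0 //;
  apply: in_FD => //; apply: in_F_opD.
have pb := @poisson_biadditive K n.
have iterH k : iter k (poisson F) H =
    iter k (poisson F) (H - H2 lam) + iter k (poisson F) (H2 lam).
  by rewrite -iter_biaddD // subrK.
have van Y k u : in_F Y -> (u <= k)%N -> wpart (iter k (poisson F) Y) u = 0.
  by move=> YF uk; rewrite wpart_iter_poisson // (iter_conv_lt pb) ?wpart0.
(* In weight [w.+1] the terms on X vanish from [k = w.+1] on, those on [H2] one step later. *)
rewrite {1}/wpart !hpartD (formal_sum_hpart (p := w.+2) FHN); last first.
  case=> // k wk; rewrite hpartZ iterH iter_poisson_H2 hpartD.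
  by rewrite [X in X + _]van ?[X in _ + X]van ?addr0 ?scaler0 // ltnW.
under eq_bigr do rewrite hpartZ iterH hpartD scalerDr.
rewrite big_split /= /recursion.
have -> : \sum_(i < w.+2) (i`!%:R^-1 : K) *:
      hpart (w.+1 + 2) (iter i (poisson F) (H - H2 lam)) =
    \sum_(0 <= k < w.+1) inv_fact K k *:
      iter k (conv (@poisson K n) (wpart F)) (wpart (H - H2 lam)) w.+1.
  rewrite big_ord_recr /= -iterS [X in _ *: X]van // scaler0 addr0 big_mkord.
  by apply: eq_bigr => i _; rewrite -wpart_iter_poisson.
have -> : \sum_(i < w.+2) (i`!%:R^-1 : K) *:
      hpart (w.+1 + 2) (iter i (poisson F) (H2 lam)) =
    wpart (H2 lam) w.+1 + (wpart (- opD lam F) w.+1 +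
    \sum_(1 <= k < w.+1) inv_factS K k *:
      iter k (conv (@poisson K n) (wpart F)) (wpart (- opD lam F)) w.+1).
  rewrite big_ord_recl fact0 invr1 scale1r; congr (_ + _).
  rewrite -(big_mkord xpredT (fun i => (i.+1`!%:R^-1 : K) *:
    hpart (w.+1 + 2) (iter i.+1 (poisson F) (H2 lam)))) big_ltn // invr1 scale1r.
  rewrite [iter 1 _ _]/= poisson_H2; congr (_ + _); apply: eq_bigr => i _.
  by rewrite iter_poisson_H2 -wpart_iter_poisson.
rewrite /wpart !hpartN.
by rewrite [hpart _ (H2 _) + _]addrC addrA addrK [- _ + _]addrC addrA subrK.
Qed.

Lemma normal_form_recursion H N : in_F (H - H2 lam) -> is_normal_form lam H N ->
  exists2 G : nat -> series K n, opA lam \o G = wpart (N - H2 lam) &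
  G =1 recursion (inv_fact K) (inv_factS K) (@poisson K n) (opB lam \o G)
    (wpart (H - H2 lam)) ((fun f => opA lam f - f) \o G).
Proof.
move=> XF [F [FF AF FHN NF AN]].
have AG : opA lam (N - H2 lam + opD lam F) = N - H2 lam by rewrite opAD opA_opD addr0.
exists (wpart (N - H2 lam + opD lam F)) => [|w].
  by apply/funext => w; rewrite /= -hpart_opA AG.
rewrite (wpart_exp_ad _ FF XF FHN NF).
congr (recursion _ _ _ _ _ _ _); apply/funext => v /=.
  (* B D F = F - A F = F, and B N_* = B A N_* = 0. *)
  by rewrite -hpart_opB opBD opB_opD AF subr0 -[N - _]AN opB_opA add0r.
rewrite -hpart_opA AG /wpart [hpart _ (_ + opD _ _)]hpartD hpartN.
by rewrite opprD addrA subrr add0r.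
Qed.

End NormalForm.

(** * The recursion for the operators Lambda_s *)

Section Lambda.
Variables (K : fieldType) (n : nat) (lam : 'I_n -> K) (h : nat -> series K n).
Implicit Types (P R : oper K n) (L : nat -> oper K n) (ss ws : seq nat).

Let opC (f : series K n) := opA lam f - f.

(* The part of arity s of the substitution of [sum_w h w] for all the arguments
   of [P], split by weight. *)
Definition subst_parts (s : nat) P : nat -> series K n :=
  fun w => \sum_(ws <- compositions 1 s w) P [seq h v | v <- ws].

Lemma subst_parts_supported (L : nat -> oper K n) :
  supported (fun s => subst_parts s (L s)).
Proof.
move=> s w ws; rewrite /subst_parts big_seq big1 // => vs.
rewrite mem_compositions => /and3P[/eqP sz hv /eqP sm].
suff: (s <= w)%N by rewrite leqNgt ws.
rewrite -sz -sm; elim: vs hv {sz sm} => //= v vs IH /andP[v0 /IH].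
by rewrite -add1n; apply: leq_add.
Qed.

Lemma subst_parts_sum s I (r : seq I) (p : pred I) (P : I -> oper K n) :
  subst_parts s (fun Gs => \sum_(i <- r | p i) P i Gs) =
  \sum_(i <- r | p i) subst_parts s (P i).
Proof. by apply/funext => w; rewrite fct_sumE exchange_big. Qed.

Lemma subst_partsD s P R :
  subst_parts s (fun Gs => P Gs + R Gs) = subst_parts s P + subst_parts s R.
Proof. by apply/funext => w; rewrite /subst_parts big_split. Qed.

Lemma subst_partsZ s (c : K) P :
  subst_parts s (fun Gs => c *: P Gs) = c *: subst_parts s P.
Proof. by apply/funext => w; rewrite /subst_parts -scaler_sumr. Qed.

Lemma subst_parts_ext s P R : P =1 R -> subst_parts s P = subst_parts s R.
Proof. by move=> PR; apply/funext => w; apply: eq_bigr. Qed.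

(** Substitution turns the bracket of operators into the weight convolution: the list of arguments
    is cut after [s] entries. *)
Lemma subst_parts_poisson s r P R :
  subst_parts (s + r) (oper_poisson s P R) =
  conv (@poisson K n) (subst_parts s P) (subst_parts r R).
Proof.
apply/funext => w; rewrite /subst_parts /conv sum_compositions_cat.
apply: eq_bigr => a _; rewrite (biadd_suml (@poisson_biadditive K n)).
rewrite big_seq [RHS]big_seq; apply: eq_bigr => p.
rewrite mem_compositions => /and3P[/eqP sz _ _].
rewrite (biadd_sumr (@poisson_biadditive K n)); apply: eq_bigr => q _.
have sz' : size [seq h v | v <- p] = s by rewrite size_map.
by rewrite /oper_poisson map_cat take_size_cat ?drop_size_cat.
Qed.

Lemma subst_parts_opB s P :
  subst_parts s (fun Gs => opB lam (P Gs)) = opB lam \o subst_parts s P.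
Proof. by apply/funext => w; rewrite /= /subst_parts opB_sum. Qed.

Lemma subst_parts_opC s P :
  subst_parts s (fun Gs => opC (P Gs)) = opC \o subst_parts s P.
Proof. by apply/funext => w; rewrite /= /subst_parts /opC opA_sum sumrB. Qed.

Section Nested.
Variable L : nat -> oper K n.
Hypothesis L0 : L 0%N [::] = 0.

Lemma subst_parts0 : subst_parts 0 (L 0%N) = 0.
Proof. by apply/funext => w; rewrite /subst_parts sum_compositions0 L0 if_same. Qed.

(** The operator ad_{BG} on doubly graded families: the outer convolution adds arities, the inner
    one weights. *)
Let ad := conv (conv (@poisson K n)) (fun s => opB lam \o subst_parts s (L s)).

Let Bconv_biadd := conv_biadditive (@poisson_biadditive K n).

Let U0 : opB lam \o subst_parts 0 (L 0%N) = 0.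
Proof. by rewrite subst_parts0; apply/funext => w; rewrite /= opB0. Qed.

(** The innermost identity takes one argument, so it is a source concentrated in arity 1 and the
    other parts sum to [s.-1]. *)
Lemma sum_nested_id k s : (0 < s)%N ->
  \sum_(ss <- compositions 1 k s.-1) subst_parts s (nested lam L ss (@oper_id K n)) =
  iter k ad (fun t => if t == 1%N then subst_parts 1 (@oper_id K n) else 0) s.
Proof.
elim: k s => [|k IH] [|s] // _.
  by rewrite sum_compositions0 /= eqSS; case: eqP => // ->.
rewrite sum_compositions_cons iterS /ad convE big_ord_recr /= subnn.
(* The convolution has one more term than the sum over compositions; it pairs with an iterate in
   arity 0, which is zero. *)
rewrite [X in _ + X](_ : _ = 0) ?addr0; last first.
  by rewrite (iter_conv_lt Bconv_biadd) ?(biadd0r Bconv_biadd).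
rewrite big_mkcond; apply: eq_bigr => -[[|i] /=].
  by rewrite U0 (biadd0l Bconv_biadd).
move=> is_ _; have -> : (s - i.+1 = (s.+1 - i.+1).-1)%N by rewrite subSn.
rewrite -IH ?subn_gt0 // (biadd_sumr Bconv_biadd); apply: eq_bigr => ss _.
rewrite -subst_parts_opB -[RHS]subst_parts_poisson subnKC //; exact: ltnW.
Qed.

(** Here the last part of the composition is the arity of the innermost operator. *)
Lemma sum_nested_last (R : nat -> oper K n) k s : subst_parts 0 (R 0%N) = 0 ->
  \sum_(ss <- compositions 1 k.+1 s)
    subst_parts s (nested lam L (take k ss) (R (nth 0%N ss k))) =
  iter k ad (fun t => subst_parts t (R t)) s.
Proof.
move=> R0; elim: k s => [|k IH] s.
  rewrite sum_compositions1; case: ltnP => //=.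
  by rewrite leqn0 => /eqP ->; rewrite R0.
rewrite sum_compositions_cons iterS /ad convE big_mkcond.
apply: eq_bigr => -[[|i] /=].
  by rewrite U0 (biadd0l Bconv_biadd).
rewrite ltnS => is_ _.
rewrite -IH (biadd_sumr Bconv_biadd); apply: eq_bigr => ss _.
by rewrite -subst_parts_opB -[RHS]subst_parts_poisson subnKC.
Qed.

End Nested.

Definition Lambda_parts (s : nat) := subst_parts s (Lambda lam s).

(** [Lambda lam 0] is the default [oper_id], which returns 0 on the empty list. *)
Lemma Lambda_parts0 : Lambda_parts 0 = 0.
Proof. exact: subst_parts0. Qed.

Lemma Lambda_parts_recursion :
  Lambda_parts =1 recursion (inv_fact K) (inv_factS K) (conv (@poisson K n))
    (fun s => opB lam \o Lambda_parts s)
    (fun s => if s == 1%N then subst_parts 1 (@oper_id K n) else 0)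
    (fun s => opC \o Lambda_parts s).
Proof.
have C0 : opC \o Lambda_parts 0 = 0.
  by rewrite Lambda_parts0; apply/funext => w; rewrite /= /opC opA0 subrr.
case=> [|[|s]].
- by rewrite Lambda_parts0 /recursion !big_geq // addr0.
- by rewrite /recursion big_nat1 big_geq // addr0 /= /inv_fact fact0 invr1 scale1r.
rewrite /Lambda_parts (subst_parts_ext _ (LambdaE lam s.+2)) /Lambda_step.
(* In arity at least 2 the [k = 0] term is zero, the source living in arity 1. *)
rewrite /recursion [X in X + _]big_ltn //= scaler0 add0r.
rewrite (_ : (fun Gs => _ + _) = fun Gs =>
  (\sum_(1 <= k < s.+2) k`!%:R^-1 *: \sum_(ss <- compositions 1 k s.+1)
    nested lam (Lambda lam) ss (@oper_id K n) Gs) +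
  (\sum_(1 <= k < s.+2) k.+1`!%:R^-1 *: \sum_(ss <- compositions 1 k.+1 s.+2)
    nested lam (Lambda lam) (take k ss)
      (fun Gs' => opC (Lambda lam (nth 0%N ss k) Gs')) Gs)) //.
rewrite subst_partsD !subst_parts_sum; congr (_ + _); apply: eq_bigr => k _;
  rewrite subst_partsZ subst_parts_sum; congr (_ *: _).
  by rewrite -sum_nested_id.
rewrite (sum_nested_last _ (R := fun t Gs => opC (Lambda lam t Gs))) //.
  by congr (iter _ _ _ _); apply/funext => t; rewrite subst_parts_opC.
by rewrite subst_parts_opC.
Qed.

Lemma total_Lambda_parts_recursion : h 0%N = 0 ->
  total_parts Lambda_parts =1 recursion (inv_fact K) (inv_factS K) (@poisson K n)
    (opB lam \o total_parts Lambda_parts) h (opC \o total_parts Lambda_parts).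
Proof.
move=> h0.
have sT : supported Lambda_parts by apply: subst_parts_supported.
have id1 w : subst_parts 1 (@oper_id K n) w = h w.
  by rewrite /subst_parts sum_compositions1; case: w.
have X1 : total_parts (fun s => if s == 1%N then subst_parts 1 (@oper_id K n) else 0) = h.
  (* In weight 0 only arity 0 is summed, so [h 0] must vanish. *)
  apply/funext => -[|w]; rewrite /total_parts; first by rewrite big_ord1 h0.
  rewrite big_ord_recl big_ord_recl /= id1 big1 ?addr0 ?add0r // => i _.
have C0 : opC 0 = 0 by rewrite /opC opA0 subrr.
move=> w; rewrite (total_recursion (@poisson_biadditive K n) _ _ _ _ _ _
  Lambda_parts_recursion).
- rewrite X1; congr (recursion _ _ _ _ _ _ _); apply/funext => v /=.
    by rewrite /total_parts opB_sum.
  by rewrite /total_parts /opC opA_sum sumrB.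
- by move=> s v vs; rewrite /= sT // opB0.
- by move=> s v; case: eqP => // ->; rewrite ltnS leqn0 => /eqP ->; rewrite id1.
- by move=> s v vs; rewrite /= sT.
- by rewrite Lambda_parts0; apply/funext => v; rewrite /= opB0.
- by [].
- by rewrite Lambda_parts0; apply/funext => v; rewrite /= C0.
Qed.

End Lambda.

(** * Comparison of the two solutions and return to degrees *)

Lemma hpart_subH2 (K : fieldType) n (lam : 'I_n -> K) (f : series K n) m :
  (3 <= m)%N -> hpart m (f - H2 lam) = hpart m f.
Proof.
move=> m3; rewrite hpartD (_ : hpart m (- _) = 0) ?addr0 //.
apply/funext => a; apply/funext => b; rewrite /hpart seriesNE /H2.
case: eqP => // ab; rewrite big1 ?oppr0 // => j _.
case: andP => // -[/eqP aj /eqP bj].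
by move: m3; rewrite -ab aj bj !mdeg1.
Qed.

Lemma normal_form_Lambda (K : fieldType) n (lam : 'I_n -> K) (H N : series K n) :
  in_F (H - H2 lam) -> is_normal_form lam H N -> forall w,
  wpart (N - H2 lam) w =
  opA lam (total_parts (Lambda_parts lam (wpart (H - H2 lam))) w).
Proof.
move=> hH hN w; have [G <- hG] := normal_form_recursion hH hN; congr (opA lam _).
pose C (f : series K n) := opA lam f - f.
have C0 : C 0 = 0 by rewrite /C opA0 subrr.
apply: (recursion_unique (@poisson_biadditive K n) (opB0 lam) C0 (wpart0 hH) hG).
exact: total_Lambda_parts_recursion (wpart0 hH).
Qed.

Theorem mainTheorem3 (R : realType) (n : nat) (hn : (1 <= n)%N)
    (lam : 'I_n -> R[i]) (H N : series R[i] n)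
    (hH : in_F (H - H2 lam)) (hN : is_normal_form lam H N)
    (m : nat) (hm : (3 <= m)%N) :
  hpart m N =
    \sum_(1 <= s < (m - 2).+1)
      \sum_(js <- compositions 3 s (m - 2 + 2 * s))
        opA lam (Lambda lam s [seq hpart j H | j <- js]).
Proof.
have := normal_form_Lambda hH hN (m - 2); rewrite /wpart subnK; last exact: ltnW.
rewrite hpart_subH2 // => ->; rewrite /total_parts opA_sum.
rewrite big_ord_recl Lambda_parts0 opA0 add0r big_add1 big_mkord /=.
apply: eq_bigr => s _; rewrite opA_sum sum_compositions_shift big_seq [RHS]big_seq.
apply: eq_bigr => ws; rewrite mem_compositions => /and3P[_ /allP ws1 _].
(* Parts are at least 1, so only degrees at least 3 occur, where [H] and [H - H2 lam] agree. *)
congr (opA lam (Lambda lam _ _)); rewrite -map_comp; apply/eq_in_map => v /ws1 v1.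
by rewrite /= /wpart hpart_subH2 // addn2 ltnS.
Qed.
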